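(* Let $\varepsilon>0$. For any $p>0$, the volume doubling property fails for the measure $m_p$ on $E$; that is, there does not exist a constant $C>0$ such that $m_p(B_\rho(x,2r))\le C\,m_p(B_\rho(x,r))$ for all $x\in E$ and every $r\in(0,1]$.
   Context: Notation: $\mathbb{R}_+=[0,\infty)$. Let $B_\varepsilon$ be the closed disk in $\mathbb{R}^2$ centered at the origin with radius $\varepsilon$, and $D_0=\mathbb{R}^2\setminus B_\varepsilon$. Identify $B_\varepsilon$ with a single point $a^*$, and let $E=D_0\cup\{a^*\}\cup\mathbb{R}_+$, with the origin of $\mathbb{R}_+$ identified with $a^*$. Let $m_p$ be the measure on $E$ whose restrictions to $\mathbb{R}_+$ and $D_0$ are Lebesgue measure multiplied by $p$ and $1$, respectively; $m_p(\{a^*\})=0$. $\rho$ is the geodesic (shortest path) metric on $E$ induced from the Euclidean space: with $|x|_\rho:=\rho(x,a^* )$, one has $|x|_\rho=|x|-\varepsilon$ for $x\in D_0$, $\rho(x,y)=\min\{|x-y|,|x|_\rho+|y|_\rho\}$ for $x,y\in D_0$, $\rho(x,y)=|x|+|y|-\varepsilon$ for $x\in\mathbb{R}_+$, $y\in D_0$, and $\rho(x,y)=|x-y|$ for $x,y\in\mathbb{R}_+$. $B_\rho(x,r)$ denotes the open ball of center $x$ and radius $r$ in $(E,\rho)$. *)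

(* Defs.v *)
From HB Require Import structures.
From mathcomp Require Import all_boot all_order all_algebra.
From mathcomp Require Import ring lra.
From mathcomp Require Import all_classical all_reals all_analysis.
From mathcomp Require Import measurable_realfun.

Set Implicit Arguments.
Unset Strict Implicit.
Unset Printing Implicit Defensive.
Import Order.TTheory GRing.Theory Num.Theory.
Import numFieldNormedType.Exports.

Local Open Scope classical_set_scope.
Local Open Scope ring_scope.

(* The library norm on [R * R] is the sup norm. *)
Definition enorm {R : realType} (z : R * R) : R :=
  Num.sqrt (z.1 ^+ 2 + z.2 ^+ 2).

Section enorm_theory.
Context {R : realType}.
Implicit Types x y z : R * R.

Lemma enorm_ge0 z : 0 <= enorm z. Proof. exact: sqrtr_ge0. Qed.

Lemma enorm_sqr z : enorm z ^+ 2 = z.1 ^+ 2 + z.2 ^+ 2.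
Proof. by rewrite sqr_sqrtr// addr_ge0// sqr_ge0. Qed.

Lemma enormN z : enorm (- z) = enorm z.
Proof. by rewrite /enorm /= !sqrrN. Qed.

Lemma enorm_eq0 z : enorm z = 0 -> z = 0.
Proof.
move=> z0; have := enorm_sqr z; rewrite z0 expr0n/= => /esym/eqP.
rewrite paddr_eq0 ?sqr_ge0// !sqrf_eq0 => /andP[/eqP a /eqP b].
by case: z a b {z0} => a b /= -> ->.
Qed.

Lemma enormD x y : enorm (x + y) <= enorm x + enorm y.
Proof.
have x0 := enorm_ge0 x; have y0 := enorm_ge0 y.
rewrite -(@ler_pXn2r _ 2)// ?nnegrE ?addr_ge0// ?enorm_ge0//.
rewrite sqrrD !enorm_sqr /=.
suff: x.1 * y.1 + x.2 * y.2 <= enorm x * enorm y by lra.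
apply: le_trans (ler_norm _) _.
rewrite -(@ler_pXn2r _ 2)// ?nnegrE ?mulr_ge0//.
rewrite real_normK ?num_real// exprMn !enorm_sqr.
have := sqr_ge0 (x.1 * y.2 - x.2 * y.1); lra.
Qed.

Lemma enorm_distC x y : enorm (x - y) = enorm (y - x).
Proof. by rewrite -opprB enormN. Qed.

Lemma enorm_triangle y x z : enorm (x - z) <= enorm (x - y) + enorm (y - z).
Proof. by rewrite (le_trans _ (enormD _ _))// addrA subrK. Qed.

Lemma enorm_sub x y : enorm x <= enorm (x - y) + enorm y.
Proof. by rewrite -{1}(subrK y x) enormD. Qed.

Lemma enorm_le z : enorm z <= `|z.1| + `|z.2|.
Proof.
rewrite -(@ler_pXn2r _ 2)// ?nnegrE ?addr_ge0// ?enorm_ge0//.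
rewrite enorm_sqr sqrrD !real_normK ?num_real//.
have : 0 <= `|z.1| * `|z.2| by rewrite mulr_ge0.
lra.
Qed.

Lemma open_measurable_plane (U : set (R * R)) : open U -> measurable U.
Proof.
move=> oU.
pose box (i : (rat * rat) * nat) : set (R * R) :=
  ball (ratr i.1.1 : R) (i.2.+1%:R^-1 : R)
  `*` ball (ratr i.1.2 : R) (i.2.+1%:R^-1 : R).
have -> : U = \bigcup_(i in [set i | box i `<=` U]) box i.
  apply/seteqP; split => [[a b] Uab|x [i Di]]; last exact: Di.
  have /nbhs_ballP[r /= r0 rU] : nbhs (a, b) U by exact: open_nbhs_nbhs.
  have rh : 0 < r / 2 by rewrite divr_gt0.
  have [n _ nr] := near_infty_natSinv_lt (PosNum rh).
  have {}nr : n.+1%:R^-1 < r / 2 := nr n (leqnn n).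
  have n0 : 0 < n.+1%:R^-1 :> R by rewrite invr_gt0.
  have hq (c : R) : exists q : rat, `|c - ratr q| < n.+1%:R^-1.
    have cn : c - n.+1%:R^-1 < c + n.+1%:R^-1.
      by rewrite ltrD2l (lt_trans _ n0)// oppr_lt0.
    have [q] := rat_in_itvoo cn.
    rewrite in_itv/= => /andP[q1 q2].
    by exists q; rewrite ltr_distlC q1 q2.
  have [q1 hq1] := hq a; have [q2 hq2] := hq b.
  exists ((q1, q2), n) => /=; last first.
    by split; rewrite /ball/= distrC.
  move=> [c d] [/= hc hd]; apply: rU; split => /=.
  - rewrite /ball/= in hc *.
    rewrite (le_lt_trans (ler_distD (ratr q1) _ _))// [ltRHS]splitr ltrD//.
      by rewrite (lt_trans _ nr).
    by rewrite (lt_trans hc).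
  - rewrite /ball/= in hd *.
    rewrite (le_lt_trans (ler_distD (ratr q2) _ _))// [ltRHS]splitr ltrD//.
      by rewrite (lt_trans _ nr).
    by rewrite (lt_trans hd).
rewrite bigcup_mkcond; apply: countable_bigcupT_measurable => // i.
case: ifPn => _ //; by apply: measurableX; apply: open_measurable; apply: ball_open.
Qed.

End enorm_theory.

(* $E$ as a disjoint union of $D_0$ and $\mathbb{R}_+$: the point $a^*$ to   *)
(* which the disk is collapsed is the origin of the half line.               *)
Inductive vdspace (R : realType) (eps : R) : Type :=
| Plane (z : R * R) of eps < enorm z
| Ray (t : R) of 0 <= t.
Arguments Plane {R eps} z _.
Arguments Ray {R eps} t _.

Definition vdstar {R : realType} {eps : R} : vdspace eps := Ray 0 (lexx 0).

Section vdspace_metric.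
Context {R : realType} {eps : R}.
Local Notation E := (vdspace eps).
Implicit Types u v w : E.

HB.instance Definition _ := gen_eqMixin E.
HB.instance Definition _ := gen_choiceMixin E.
HB.instance Definition _ := isPointed.Build E vdstar.

(* $|u|_\rho$, the distance from [u] to $a^*$. *)
Definition vdabs u : R :=
  match u with Plane z _ => enorm z - eps | Ray t _ => t end.

(* The length of a shortest path from [u] to [v]: between two points of the   *)
(* plane it is either the straight segment or a path through $a^*$.          *)
Definition vddist u v : R :=
  match u, v with
  | Plane x _, Plane y _ => Num.min (enorm (x - y)) (vdabs u + vdabs v)
  | Ray s _, Ray t _ => `|s - t|
  | _, _ => vdabs u + vdabs v
  end.

Lemma vdabs_ge0 u : 0 <= vdabs u.
Proof. by case: u => [z hz|t ht] //=; rewrite subr_ge0 ltW. Qed.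

Lemma Plane_eq (x y : R * R) hx hy : x = y -> Plane x hx = Plane y hy :> E.
Proof. by move=> xy; subst y; congr Plane; exact: bool_irrelevance. Qed.

Lemma Ray_eq (s t : R) hs ht : s = t -> Ray s hs = Ray t ht :> E.
Proof. by move=> st; subst t; congr Ray; exact: bool_irrelevance. Qed.

Lemma vddistxx u : vddist u u = 0.
Proof.
case: u => [z hz|t ht] /=; last by rewrite subrr normr0.
rewrite subrr /enorm /= expr0n/= addr0 sqrtr0.
by apply/min_idPl; rewrite addr_ge0// subr_ge0 ltW.
Qed.

Lemma vddist_eq0 u v : vddist u v = 0 -> u = v.
Proof.
case: u v => [x hx|s hs] [y hy|t ht] /=.
- rewrite /Num.min; case: ifPn => _; last by move=> xy; exfalso; lra.
  by move=> /enorm_eq0/subr0_eq; exact: Plane_eq.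
- by move=> xt; exfalso; lra.
- by move=> sy; exfalso; lra.
- by move/normr0_eq0/subr0_eq; exact: Ray_eq.
Qed.

Lemma vddistC u v : vddist u v = vddist v u.
Proof.
case: u v => [x hx|s hs] [y hy|t ht] /=.
- by rewrite enorm_distC [X in Num.min _ X]addrC.
- exact: addrC.
- exact: addrC.
- exact: distrC.
Qed.

Lemma vddist_triangle v u w : vddist u w <= vddist u v + vddist v w.
Proof.
case: u v w => [x hx|s hs] [y hy|t ht] [z hz|r hr] /=.
- have := enorm_triangle y x z.
  have := enorm_sub x y; have := enorm_sub z y; rewrite (enorm_distC z y).
  move: (enorm (x - z)) (enorm (x - y)) (enorm (y - z)) hx hy hz.
  move: (enorm x) (enorm y) (enorm z) => a b c xz xy yz ha hb hc h1 h2 h3.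
  rewrite ge_min; case: (leP xy) => _; case: (leP yz) => _.
  + by rewrite h3.
  + by apply/orP; right; lra.
  + by apply/orP; right; lra.
  + by apply/orP; right; lra.
- have xy := enorm_sub x y.
  by case: (leP (enorm (x - y))) => _; lra.
- by rewrite ge_min; apply/orP; right; lra.
- have := ler_norm (r - t); rewrite distrC; lra.
- have := enorm_sub z y; rewrite (enorm_distC z y) => zy.
  by case: (leP (enorm (y - z))) => _; lra.
- by have : `|s - r| <= s + r; [rewrite ler_norml; lra|lra].
- have := ler_norm (s - t); lra.
- exact: ler_distD.
Qed.

HB.instance Definition _ := isMetric.Build R E
  vddistxx vddist_eq0 vddistC vddist_triangle.

Lemma vdballE u (r : R) : ball u r = [set v | vddist u v < r].
Proof. exact: ballEmdist. Qed.

HB.instance Definition _ := @isMeasurable.Build (sigma_display (@open E)) E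
  <<s @open E >> (@sigma_algebra0 _ setT _) (@sigma_algebraC _ _)
  (@sigma_algebra_bigcup _ setT _).

End vdspace_metric.

Section vdmeasure.
Context {R : realType} {eps : R}.
Local Notation E := (vdspace eps).
Implicit Types A : set E.

Definition plane_part A : set (R * R) :=
  [set z | exists hz : eps < enorm z, A (Plane z hz)].

Definition ray_part A : set R := [set t | exists ht : 0 <= t, A (Ray t ht)].

Let plane_part_bigcup (F : (set E)^nat) :
  plane_part (\bigcup_i F i) = \bigcup_i plane_part (F i).
Proof.
apply/seteqP; split => [z [hz [i _ Fz]]|z [i _ [hz Fz]]].
  by exists i => //; exists hz.
by exists hz, i.
Qed.

Let ray_part_bigcup (F : (set E)^nat) :
  ray_part (\bigcup_i F i) = \bigcup_i ray_part (F i).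
Proof.
apply/seteqP; split => [z [hz [i _ Fz]]|z [i _ [hz Fz]]].
  by exists i => //; exists hz.
by exists hz, i.
Qed.

Let open_plane_part A : open A -> open (plane_part A).
Proof.
move=> oA; rewrite openE => z [hz Az].
have /nbhs_ballP[e /= e0 eA] : nbhs (Plane z hz) A by exact: open_nbhs_nbhs.
pose d := Num.min e (enorm z - eps) / 2.
have d0 : 0 < d by rewrite divr_gt0// lt_min e0 subr_gt0.
apply/nbhs_ballP; exists d => //= w [/= zw1 zw2].
have : enorm (z - w) < d + d.
  by rewrite (le_lt_trans (enorm_le _))// ltrD.
rewrite -splitr lt_min => /andP[zwe zweps].
have hw : eps < enorm w by have := enorm_sub z w; lra.
exists hw; apply: eA; rewrite ballEmdist.
by change (vddist (Plane z hz) (Plane w hw) < e); rewrite /= gt_min zwe.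
Qed.

Lemma measurable_plane_part A : measurable A -> measurable (plane_part A).
Proof.
have mT : measurable (plane_part setT).
  by apply: open_measurable_plane; apply: open_plane_part; exact: openT.
apply: (smallest_sub (X := [set A | measurable (plane_part A)])).
  split => [|B mB|F mF] /=.
  - by rewrite (_ : plane_part set0 = set0)//; apply/seteqP; split => // z [].
  - rewrite (_ : plane_part _ = plane_part setT `\` plane_part B).
      exact: measurableD.
    apply/seteqP; split => [z [hz [_ nB]]|z [[hz _] nB]].
      split; first by exists hz.
      by move=> [hz']; rewrite (bool_irrelevance hz' hz).
    by exists hz; split => // Bz; apply: nB; exists hz.
  - by rewrite plane_part_bigcup; exact: bigcupT_measurable.
by move=> U oU; apply: open_measurable_plane; exact: open_plane_part.
Qed.

Let open_ray_part A : open A -> measurable (ray_part A).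
Proof.
move=> oA.
have -> : ray_part A = `[0, +oo[ `&` [set t | 0 <= t -> ray_part A t]°.
  apply/seteqP; split => [t [ht At]|t []/=]; last first.
    by rewrite in_itv/= andbT => t0 /interior_subset; exact.
  split; first by rewrite /= in_itv/= andbT.
  have /nbhs_ballP[e /= e0 eA] : nbhs (Ray t ht) A by exact: open_nbhs_nbhs.
  apply/nbhs_ballP; exists e => //= s ts hs; exists hs; apply: eA.
  by rewrite ballEmdist.
by apply: measurableI => //; apply: open_measurable; exact: open_interior.
Qed.

Lemma measurable_ray_part A : measurable A -> measurable (ray_part A).
Proof.
have mT : measurable (ray_part setT) by apply: open_ray_part; exact: openT.
apply: (smallest_sub (X := [set A | measurable (ray_part A)])).
  split => [|B mB|F mF] /=.
  - by rewrite (_ : ray_part set0 = set0)//; apply/seteqP; split => // z [].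
  - rewrite (_ : ray_part _ = ray_part setT `\` ray_part B).
      exact: measurableD.
    apply/seteqP; split => [z [hz [_ nB]]|z [[hz _] nB]].
      split; first by exists hz.
      by move=> [hz']; rewrite (bool_irrelevance hz' hz).
    by exists hz; split => // Bz; apply: nB; exists hz.
  - by rewrite ray_part_bigcup; exact: bigcupT_measurable.
by move=> U oU; exact: open_ray_part.
Qed.

Definition plane_measure A : \bar R := 
  (@lebesgue_measure R \x @lebesgue_measure R)%E (plane_part A).

Definition ray_measure A : \bar R := lebesgue_measure (ray_part A).

Let plane_measure0 : plane_measure set0 = 0%E.
Proof.
rewrite /plane_measure (_ : plane_part set0 = set0) ?measure0//.
by apply/seteqP; split => // z [].
Qed.

Let plane_measure_ge0 A : (0 <= plane_measure A)%E.
Proof. exact: measure_ge0. Qed.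

Let plane_measure_sigma_additive : semi_sigma_additive plane_measure.
Proof.
move=> F mF tF mUF; rewrite /plane_measure plane_part_bigcup.
apply: measure_semi_sigma_additive.
- by move=> n; exact: measurable_plane_part.
- apply/trivIsetP => i j _ _ ij; move/trivIsetP : tF => /(_ i j I I ij) Fij.
  apply/seteqP; split => // z [[hz Fi] [hz' Fj]].
  suff : (F i `&` F j) (Plane z hz) by rewrite Fij.
  by split=> //; rewrite (bool_irrelevance hz hz').
- by rewrite -plane_part_bigcup; exact: measurable_plane_part.
Qed.

HB.instance Definition _ := isMeasure.Build _ _ _ plane_measure
  plane_measure0 plane_measure_ge0 plane_measure_sigma_additive.

Let ray_measure0 : ray_measure set0 = 0%E.
Proof.
rewrite /ray_measure (_ : ray_part set0 = set0) ?measure0//.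
by apply/seteqP; split => // z [].
Qed.

Let ray_measure_ge0 A : (0 <= ray_measure A)%E.
Proof. exact: measure_ge0. Qed.

Let ray_measure_sigma_additive : semi_sigma_additive ray_measure.
Proof.
move=> F mF tF mUF; rewrite /ray_measure ray_part_bigcup.
apply: measure_semi_sigma_additive.
- by move=> n; exact: measurable_ray_part.
- apply/trivIsetP => i j _ _ ij; move/trivIsetP : tF => /(_ i j I I ij) Fij.
  apply/seteqP; split => // z [[hz Fi] [hz' Fj]].
  suff : (F i `&` F j) (Ray z hz) by rewrite Fij.
  by split=> //; rewrite (bool_irrelevance hz hz').
- by rewrite -ray_part_bigcup; exact: measurable_ray_part.
Qed.

HB.instance Definition _ := isMeasure.Build _ _ _ ray_measure
  ray_measure0 ray_measure_ge0 ray_measure_sigma_additive.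

Variable p : {posnum R}.

Definition vdmeasure : set E -> \bar R :=
  measure_add plane_measure (mscale p%:num%:nng ray_measure).

HB.instance Definition _ := Measure.on vdmeasure.

Lemma vdmeasureE A :
  vdmeasure A = ((@lebesgue_measure R \x @lebesgue_measure R) (plane_part A) +
                 p%:num%:E * lebesgue_measure (ray_part A))%E.
Proof. by rewrite /vdmeasure measure_addE. Qed.

Lemma vdmeasure_star : vdmeasure [set vdstar] = 0%E.
Proof.
rewrite vdmeasureE.
have -> : plane_part [set vdstar] = set0 by apply/seteqP; split => // z [].
have -> : ray_part [set vdstar] = [set 0].
  apply/seteqP; split => [t [ht [->]]//|t ->]; exists (lexx 0).
  by [].
by rewrite measure0 lebesgue_measure_set1 mule0 adde0.
Qed.

End vdmeasure.

(* Main.v *)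
Require Import Defs.
From HB Require Import structures.
From mathcomp Require Import all_boot all_order all_algebra.
From mathcomp Require Import all_classical all_reals all_analysis.
From mathcomp Require Import lra.

Import Order.TTheory GRing.Theory Num.Theory.
Import numFieldNormedType.Exports.

Local Open Scope classical_set_scope.
Local Open Scope ring_scope.

(** Near a*, the space is two-dimensional on one side and one-dimensional on
    the other, so balls of comparable radii can have measures of different
    orders.  Centre a ball at a point x of the plane at distance exactly r from
    a*.  The ball of radius r does not reach a*, so it is an ordinary
    plane set of diameter at most 2 r, whose measure is at most (2 r)^2
    ([vdmeasure_ball_le]).  The ball of radius 2 r goes through a* and covers
    a segment of length r of the half line, so its measure is at least p r
    ([vdmeasure_ball_ge]).  Doubling would thus give p r <= 4 C r^2, that is
    p <= 4 C r, which fails once r is small. *)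

Lemma metric_ball_open {R : realFieldType} {T : metricType R} (x : T) (r : R) :
  open (ball x r).
Proof.
rewrite openE => y; rewrite ballEmdist /= => xy.
apply/nbhs_ballP; exists (r - mdist x y) => /=; first by rewrite subr_gt0.
move=> z; rewrite ballEmdist /= ltrBrDl => yz.
exact: le_lt_trans (metric_triangle x y z) yz.
Qed.

Lemma measurable_vdball {R : realType} {eps : R} (x : vdspace eps) (r : R) :
  measurable (ball x r).
Proof. by apply: sub_sigma_algebra; exact: metric_ball_open. Qed.

Lemma ler_abs_enorm {R : realType} (z : R * R) :
  `|z.1| <= enorm z /\ `|z.2| <= enorm z.
Proof.
by split; rewrite -sqrtr_sqr; apply: ler_wsqrtr;
  rewrite ?lerDl ?lerDr sqr_ge0.
Qed.

(** A path leaving the plane, or a detour between two plane points, goes through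
    a* and is thus too long: the ball is a Euclidean one, which a square
    of side 2 r contains. *)
Lemma vdmeasure_ball_le {R : realType} {eps : R} (p : {posnum R})
    (x : R * R) (hx : eps < enorm x) (r : R) :
  0 < r -> r <= enorm x - eps ->
  (vdmeasure p (ball (Plane x hx) r) <= ((2 * r) ^+ 2)%:E)%E.
Proof.
move=> r0 rx; rewrite vdmeasureE.
have -> : ray_part (ball (Plane x hx) r) = set0.
  apply/seteqP; split => // t [ht]; rewrite vdballE /=.
  by move=> ?; lra.
rewrite measure0 mule0 adde0.
have itvE (a : R) : lebesgue_measure `]a - r, a + r[ = (2 * r)%:E.
  rewrite lebesgue_measure_itv/= lte_fin ifT; last lra.
  by rewrite -EFinB; congr EFin; lra.
pose box : set (R * R) := `]x.1 - r, x.1 + r[ `*` `]x.2 - r, x.2 + r[.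
have boxE : ((@lebesgue_measure R \x @lebesgue_measure R) box
             = ((2 * r) ^+ 2)%:E)%E.
  by rewrite product_measure1E//= !itvE -EFinM expr2.
rewrite -boxE; apply: le_measure; rewrite ?inE.
- by apply: measurable_plane_part; exact: measurable_vdball.
- exact: measurableX.
move=> y [hy]; rewrite vdballE /= gt_min => /orP[xy|]; last by move=> ?; lra.
have [/= xy1 xy2] := ler_abs_enorm (x - y).
split; rewrite /= in_itv/= -ltr_distlC.
- exact: le_lt_trans xy1 xy.
- exact: le_lt_trans xy2 xy.
Qed.

(** Going through a* to a point t of the half line costs at most [vdabs x + t],
    so the radius left at a* is spent on an initial segment of the half line. *)
Lemma vdmeasure_ball_ge {R : realType} {eps : R} (p : {posnum R})
    (x : vdspace eps) (r : R) :
  vdabs x <= r ->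
  ((p%:num * (r - vdabs x))%:E <= vdmeasure p (ball x r))%E.
Proof.
move=> xr; rewrite vdmeasureE EFinM.
apply: (@le_trans _ _ (p%:num%:E * lebesgue_measure (ray_part (ball x r)))%E).
  rewrite lee_pmul2l//.
  have segE : lebesgue_measure `[0, r - vdabs x[ = (r - vdabs x)%:E.
    rewrite lebesgue_measure_itv/= lte_fin; case: ltP => h.
      by rewrite -EFinB subr0.
    by congr EFin; lra.
  rewrite -segE; apply: le_measure; rewrite ?inE//.
    by apply: measurable_ray_part; exact: measurable_vdball.
  move=> t; rewrite /= in_itv/= => /andP[t0 tr]; exists t0; rewrite vdballE.
  case: x xr {segE} tr => [z hz|s hs] /= xr tr; first lra.
  by rewrite ltr_norml; lra.
by rewrite leeDr.
Qed.

Theorem proposition2p1 (R : realType) (eps p : {posnum R}) :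
  ~ exists C : R, 0 < C /\
      forall (x : vdspace eps%:num) (r : R), 0 < r <= 1 ->
        (vdmeasure p (ball x (2 * r)) <= C%:E * vdmeasure p (ball x r))%E.
Proof.
move=> [C [C0 doubling]].
have p0 : 0 < p%:num by [].
have e0 : 0 < eps%:num by [].
(* Any radius below p / (4 C) does. *)
pose r := Num.min 1 (p%:num / (8 * C)).
have r0 : 0 < r by rewrite lt_min ltr01 divr_gt0// mulr_gt0.
have r1 : r <= 1 by rewrite ge_min lexx.
have rC : r * (8 * C) <= p%:num.
  by rewrite -ler_pdivlMr ?mulr_gt0// ge_min lexx orbT.
pose x : R * R := (eps%:num + r, 0).
have xE : enorm x = eps%:num + r.
  by rewrite /enorm /= expr0n/= addr0 sqrtr_sqr gtr0_norm// addr_gt0.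
have hx : eps%:num < enorm x by rewrite xE ltrDl.
have small := @vdmeasure_ball_le R eps%:num p x hx r r0.
have large := @vdmeasure_ball_ge R eps%:num p (Plane x hx) (2 * r).
have {}small := small ltac:(lra).
have {}large := large ltac:(rewrite /=; lra).
have r01 : 0 < r <= 1 by rewrite r0.
have := le_trans large (le_trans (doubling (Plane x hx) r r01)
  (lee_wpmul2l (ltW C0 : (0 <= C%:E)%E) small)).
rewrite -EFinM lee_fin /= xE.
have -> : 2 * r - (eps%:num + r - eps%:num) = r by lra.
have -> : C * (2 * r) ^+ 2 = (4 * C * r) * r by rewrite expr2; lra.
rewrite ler_pM2r// => ?; nra.
Qed.
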